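(* Let $(X,\rho)$ be a nonempty complete metric space, let $k\in\mathbb{N}$, $k\ge 1$, and let $\psi:X\to X$ be a $k$-continuous mapping. Suppose that for some $m\in\mathbb{N}$ with $m\ge 3$ and some $\alpha\in\left[0,\frac12\right)$ the inequality $$\rho(\psi^m x,\psi^m y)\le \alpha\left(\rho(x,\psi y)+\rho(y,\psi x)\right)$$ holds for all $x,y\in X$. Then $\psi$ has a unique fixed point in $X$, and for every initial point $x_0\in X$ the iterative sequence $(\psi^n x_0)_{n\in\mathbb{N}}$ converges to this fixed point.
   Context: For a self-mapping $\psi:X\to X$, $\psi^n$ denotes the $n$-fold composition of $\psi$ with itself. A mapping $\psi:X\to X$ on a metric space is called $k$-continuous (for a natural number $k\ge 1$) if the iterate $\psi^k$ is continuous. *)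

(* Defs.v *)
From HB Require Import structures.
From mathcomp Require Import all_boot all_order all_algebra.
From mathcomp Require Import all_classical all_reals all_analysis.

Set Implicit Arguments.
Unset Strict Implicit.
Unset Printing Implicit Defensive.

(* The library's completeType extends pointed types, so these spaces are
   nonempty. *)
#[short(type="completeMetricType")]
HB.structure Definition CompleteMetric (R : numDomainType) :=
  {T of Complete T & Metric R T}.

Definition k_continuous (T : topologicalType) (k : nat) (psi : T -> T) : Prop :=
  continuous (iter k psi).

(* Main.v *)
Require Import Defs.
From mathcomp Require Import all_boot all_order all_algebra.
From mathcomp Require Import all_classical all_reals all_analysis.
From mathcomp Require Import ring lra zify.
Import Order.TTheory GRing.Theory Num.Theory.
Import numFieldNormedType.Exports.
Local Open Scope classical_set_scope.
Local Open Scope ring_scope.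

(** Along an orbit [a_i = psi^i x] the hypothesis reads
    [d(a_(i+m), a_(j+m)) <= alpha (d(a_i, a_(j+1)) + d(a_j, a_(i+1)))], so
    dropping the first [m] terms of an orbit multiplies its diameter by at most
    [2 alpha < 1].

    Once orbits are known to be bounded ([orbit_bounded]), this forces every
    orbit to be Cauchy ([orbit_cauchy]), hence to converge to some [p].
    Continuity of [psi^k] only gives [psi^k p = p] ([iter_fixed_limit]); but
    then the orbit of [p] is periodic, and a periodic Cauchy sequence is
    constant, so [psi p = p] ([periodic_fixed]).  Two fixed points [p], [q]
    satisfy [d(p, q) <= 2 alpha d(p, q)], hence coincide ([fixed_unique]);
    therefore the limits of all orbits are the same point. *)

Section IterateContraction.
Context {R : realType} {X : metricType R} (psi : X -> X) (m : nat) (alpha : R).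
Hypothesis m_gt1 : (1 < m)%N.
Hypothesis alpha_bounds : 0 <= alpha < 1 / 2.
Hypothesis contr : forall x y : X,
  mdist (iter m psi x) (iter m psi y)
    <= alpha * (mdist x (psi y) + mdist y (psi x)).

Local Notation orb x i := (iter i psi x).

(** The hypothesis read at [x := a_(i-m)], [y := a_(j-m)] compares the distance
    at indices [i], [j] only with earlier distances of the same orbit. *)
Lemma orbit_contraction (x : X) (D : R) (i j : nat) :
    (m <= i)%N -> (m <= j)%N ->
    mdist (orb x (i - m)) (orb x (j - m).+1) <= D ->
    mdist (orb x (j - m)) (orb x (i - m).+1) <= D ->
  mdist (orb x i) (orb x j) <= 2 * alpha * D.
Proof.
move=> mi mj dij dji; have /andP[a0 _] := alpha_bounds.
rewrite -[in orb x i](subnKC mi) -[in orb x j](subnKC mj) !iterD.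
apply: le_trans (contr _ _) _; rewrite (mulrC 2) -mulrA.
by apply: ler_wpM2l => //; move: dij dji => /=; lra.
Qed.

(** The bound [D] solves [2 C + 2 alpha D = D], where [C] dominates the
    distances from [a_0, ..., a_(m-1)] to [a_m].  Going through [a_m] reduces
    any pair of indices to pairs that are both at least [m], and for those the
    contraction refers only to strictly smaller indices because [m > 1]; this
    is what makes the induction on the largest index work. *)
Lemma orbit_bounded (x : X) :
  exists2 D : R, 0 <= D & forall i j, mdist (orb x i) (orb x j) <= D.
Proof.
have /andP[a0 a1] := alpha_bounds.
pose C : R := \sum_(i < m) mdist (orb x i) (orb x m).
have C0 : 0 <= C by apply: sumr_ge0 => i _; exact: mdist_ge0.
have leC i : (i < m)%N -> mdist (orb x i) (orb x m) <= C.
  move=> im; rewrite /C (bigD1 (Ordinal im)) //= lerDl.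
  by apply: sumr_ge0 => l _; exact: mdist_ge0.
have b0 : 0 < 1 - 2 * alpha by lra.
pose D := 2 * C / (1 - 2 * alpha).
have D0 : 0 <= D by rewrite divr_ge0 //; lra.
have DE : 2 * C + 2 * alpha * D = D by rewrite /D; field; rewrite lt0r_neq0.
have aD0 : 0 <= 2 * alpha * D by rewrite mulr_ge0 // mulr_ge0.
exists D => // i j.
have [N] : exists N, (i <= N)%N && (j <= N)%N.
  by exists (maxn i j); rewrite leq_maxl leq_maxr.
elim/ltn_ind: N i j => N IH i j /andP[iN jN].
have far i' j' : (m <= i' <= N)%N -> (m <= j' <= N)%N ->
    mdist (orb x i') (orb x j') <= 2 * alpha * D.
  move=> /andP[mi iN'] /andP[mj jN']; apply: orbit_contraction => //;
    by apply: (IH N.-1); lia.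
have near_far i' j' : (i' < m)%N -> (m <= j' <= N)%N ->
    mdist (orb x i') (orb x j') <= C + 2 * alpha * D.
  move=> im jm; apply: le_trans (metric_triangle _ (orb x m) _) _.
  by apply: lerD; [exact: leC | apply: far => //; lia].
case: (ltnP i m) => im; case: (ltnP j m) => jm.
- apply: le_trans (metric_triangle _ (orb x m) _) _.
  by rewrite (metric_sym (orb x m)); have := leC _ im; have := leC _ jm; lra.
- by have := near_far i j im; rewrite jm jN => /(_ isT); lra.
- by rewrite metric_sym; have := near_far j i jm; rewrite im iN => /(_ isT); lra.
- by have := far i j; rewrite im jm iN jN => /(_ isT isT); lra.
Qed.

(** Going back [m] steps from indices beyond [m * n.+1], or [m] steps and one
    forward, stays beyond [m * n], so each block of [m] terms contributes a
    factor [2 * alpha]. *)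
Lemma orbit_tail (x : X) (D : R) :
    (forall i j, mdist (orb x i) (orb x j) <= D) ->
  forall n i j, (m * n <= i)%N -> (m * n <= j)%N ->
    mdist (orb x i) (orb x j) <= (2 * alpha) ^+ n * D.
Proof.
move=> bD; elim=> [|n IH] i j ni nj; first by rewrite expr0 mul1r.
rewrite mulnS in ni nj; rewrite exprS -mulrA.
by apply: orbit_contraction; [lia | lia | apply: IH; lia | apply: IH; lia].
Qed.

Lemma orbit_cauchy (x : X) (e : R) : 0 < e ->
  exists N, forall i j, (N <= i)%N -> (N <= j)%N ->
    mdist (orb x i) (orb x j) < e.
Proof.
move=> e0; have /andP[a0 a1] := alpha_bounds.
have [D D0 bD] := orbit_bounded x.
have D1 : 0 < D + 1 by lra.
have b1 : `|2 * alpha| < 1 by rewrite ger0_norm; lra.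
have /cvgr_dist_lt /(_ _ (divr_gt0 e0 D1)) [n _ /(_ n (leqnn n))] :=
  cvg_expr b1.
rewrite /= sub0r normrN ger0_norm; last by rewrite exprn_ge0 // mulr_ge0.
rewrite ltr_pdivlMr // => ne.
exists (m * n)%N => i j ni nj; apply: le_lt_trans (orbit_tail _ _ bD _ _ _ ni nj) _.
by apply: le_lt_trans ne; rewrite ler_wpM2l ?lerDl // exprn_ge0 // mulr_ge0.
Qed.

(** Both [p] and [psi p] occur arbitrarily late in the orbit of [p], at the
    indices [N * k] and [N * k + 1], so the Cauchy property makes them equal. *)
Lemma periodic_fixed (k : nat) (p : X) :
  (0 < k)%N -> iter k psi p = p -> psi p = p.
Proof.
move=> k0 kp; have per n : orb p (n * k) = p.
  by elim: n => // n IH; rewrite mulSn iterD IH.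
apply: mdist_positivity; apply/eqP; rewrite eq_le mdist_ge0 andbT leNgt.
apply/negP => /(orbit_cauchy p) [N /(_ (N * k).+1 (N * k)%N)].
by rewrite iterS per ltxx => H; have : false by apply: H; nia.
Qed.

Lemma fixed_unique (p q : X) : psi p = p -> psi q = q -> q = p.
Proof.
move=> fp fq; have fix_iter z n : psi z = z -> orb z n = z.
  by move=> fz; elim: n => //= n ->.
have := contr q p; rewrite !fix_iter // fp fq (metric_sym p q) => qp.
apply: mdist_positivity; apply/eqP; rewrite eq_le mdist_ge0 andbT.
by have := mdist_ge0 q p; have /andP[a0 a1] := alpha_bounds; nra.
Qed.

End IterateContraction.

(** The shifted orbit [psi^(k+n) x] tends to [p] as a tail of the orbit, and to
    [psi^k p] by continuity. *)
Lemma iter_fixed_limit (T : topologicalType) (psi : T -> T) (k : nat)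
    (x p : T) :
    hausdorff_space T -> continuous (iter k psi) ->
    iter n psi x @[n --> \oo] --> p ->
  iter k psi p = p.
Proof.
move=> hT ck xp; apply: (cvg_unique hT (F := iter (k + n)%N psi x @[n --> \oo])).
  have -> : (fun n => iter (k + n)%N psi x) = (fun n => iter k psi (iter n psi x)).
    by apply/funext => n; rewrite iterD.
  exact: (continuous_cvg _ (ck p) xp).
exact: cvg_comp (@cvg_addnl k) xp.
Qed.

Theorem theorem3p1 (R : realType) (X : completeMetricType R)
    (k : nat) (hk : (1 <= k)%N) (psi : X -> X) (hpsi : k_continuous k psi)
    (m : nat) (hm : (3 <= m)%N) (alpha : R) (halpha : 0 <= alpha < 1 / 2)
    (hcontr : forall x y : X,
      mdist (iter m psi x) (iter m psi y)
        <= alpha * (mdist x (psi y) + mdist y (psi x))) :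
  exists p : X,
    [/\ psi p = p,
        forall q : X, psi q = q -> q = p
      & forall x0 : X, iter n psi x0 @[n --> \oo] --> p].
Proof.
have m1 : (1 < m)%N by apply: ltnW.
have orbit_cvg x0 : exists2 p : X, psi p = p & iter n psi x0 @[n --> \oo] --> p.
  have /cvg_ex [p xp] : cvg (iter n psi x0 @[n --> \oo]).
    apply/cauchy_cvgP/cauchyP => e e0.
    have [N HN] := orbit_cauchy _ _ _ m1 halpha hcontr x0 e e0.
    exists (iter N psi x0); exists N => // n /= Nn.
    by rewrite ballEmdist /=; exact: HN.
  exists p => //; apply: (periodic_fixed _ _ _ m1 halpha hcontr k p hk).
  exact: iter_fixed_limit (@metric_hausdorff _ X) hpsi xp.
have uniq := fixed_unique _ _ _ halpha hcontr.
have [p fp _] := orbit_cvg point.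
exists p; split=> // [q fq | x0]; first exact: uniq.
by have [q fq] := orbit_cvg x0; rewrite (uniq p q fp fq).
Qed.
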